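(* Let $Z$ be a lush Banach space over $\mathbb{F}$ (where $\mathbb{F}=\mathbb{R}$ or $\mathbb{F}=\mathbb{C}$) and let $X\subseteq Z$ be a closed subspace which is an M-ideal in $Z$. Then $X$, with the norm inherited from $Z$, is lush.
   Context: Let $\mathbb{F}$ be $\mathbb{R}$ or $\mathbb{C}$ and $\mathbb{T}=\{\omega\in\mathbb{F}: |\omega|=1\}$. For a Banach space $X$ over $\mathbb{F}$, $B_X$ denotes its closed unit ball, $S_X$ its unit sphere, and $X^*$ its dual. For $x^*\in S_{X^*}$ and $\alpha>0$ put $S(B_X,x^*,\alpha)=\{x\in B_X : \operatorname{Re} x^*(x)>1-\alpha\}$ (an open slice of the unit ball). For $F\subseteq X$, $\operatorname{co}(F)$ is the convex hull of $F$ and $\mathbb{T}F=\{\omega x:\omega\in\mathbb{T},x\in F\}$, so $\operatorname{co}(\mathbb{T}F)$ is the absolutely convex hull of $F$; $\operatorname{dist}(v,A)=\inf_{a\in A}\|v-a\|$. Lush: a Banach space $X$ is lush if for every $u,v\in S_X$ and every $\varepsilon>0$ there is $x^*\in S_{X^*}$ such that $u\in S(B_X,x^*,\varepsilon)$ and $\operatorname{dist}(v,\operatorname{co}(\mathbb{T}\,S(B_X,x^*,\varepsilon)))<\varepsilon$. L-summand: for a Banach space $W$, a linear projection $P:W\to W$ with $\|w\|=\|Pw\|+\|w-Pw\|$ for every $w\in W$ is called an L-projection, and its range is called an L-summand of $W$. M-ideal: a closed subspace $X\subseteq Z$ is an M-ideal in $Z$ if its annihilator $X^\perp=\{z^*\in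 Z^*: z^*(x)=0\text{ for all }x\in X\}$ is an L-summand in $Z^*$. *)

(* Defs.v *)
From HB Require Import structures.
From mathcomp Require Import all_boot all_order all_algebra.
From mathcomp Require Import complex.
From mathcomp Require Import all_classical all_reals.
From mathcomp Require Import ereal topology normedtype convex.

Set Implicit Arguments.
Unset Strict Implicit.
Unset Printing Implicit Defensive.

Import Order.TTheory GRing.Theory Num.Theory.
Import numFieldNormedType.Exports.

Local Open Scope classical_set_scope.
Local Open Scope ring_scope.

Variant scalar_kind := RealScalars | ComplexScalars.

Definition scalar_field (R : realType) (k : scalar_kind) : numFieldType :=
  match k with
  | RealScalars => R : numFieldType
  | ComplexScalars => R[i] : numFieldType
  end.

Definition re {R : realType} {k : scalar_kind} : scalar_field R k -> R :=
  match k with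
  | RealScalars => fun x => x
  | ComplexScalars => fun z => complex.Re z
  end.

Definition of_real {R : realType} {k : scalar_kind} : R -> scalar_field R k :=
  match k with
  | RealScalars => fun x => x
  | ComplexScalars => fun x => real_complex R x
  end.

Section scalar_theory.
Context {R : realType} {k : scalar_kind}.
Implicit Types (a b : scalar_field R k) (x y : R).

Lemma of_realK : cancel (@of_real R k) re.
Proof. by case: k. Qed.

Lemma reK a : 0 <= a -> of_real (re a) = a.
Proof.
by move: a; case: k => //= -[x y]; rewrite lecE /= => /andP[/eqP -> _].
Qed.

Lemma of_realD x y : of_real (x + y) = of_real x + of_real y :> scalar_field R k.
Proof. by case: k => //=; rewrite rmorphD. Qed.

Lemma of_realM x y : of_real (x * y) = of_real x * of_real y :> scalar_field R k.
Proof. by case: k => //=; rewrite rmorphM. Qed.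

Lemma of_real0 : of_real 0 = 0 :> scalar_field R k.
Proof. by case: k. Qed.

Lemma le_of_real x y : (of_real x <= of_real y :> scalar_field R k) = (x <= y).
Proof. by case: k => //=; rewrite lecR. Qed.

Lemma re_ge0 a : 0 <= a -> 0 <= re a.
Proof. by move=> a0; rewrite -le_of_real of_real0 reK. Qed.

Lemma le_re a b : 0 <= a -> a <= b -> re a <= re b.
Proof. by move=> a0 ab; rewrite -le_of_real !reK// (le_trans a0). Qed.

Lemma reD a b : re (a + b) = re a + re b.
Proof. by move: a b; case: k => //= -[? ?] [? ?]. Qed.

Lemma re_norm_mul a b : re (`|a| * `|b|) = re `|a| * re `|b|.
Proof.
rewrite -[in LHS](reK (normr_ge0 a)) -[in LHS](reK (normr_ge0 b)).
by rewrite -of_realM of_realK.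
Qed.

End scalar_theory.

Section normed_space.
Context {R : realType} {k : scalar_kind}.
Local Notation K := (scalar_field R k).

Definition unit_ball (V : normedModType K) : set V := [set x | `|x| <= 1].

Definition unit_sphere (V : normedModType K) : set V := [set x | `|x| = 1].

(* The value lies in [\bar R] so that the distance to the empty set is +oo. *)
Definition dist (V : normedModType K) (v : V) (A : set V) : \bar R :=
  ereal_inf [set (re `|v - a|)%:E | a in A].

Definition convex_hull (V : lmodType K) (A : set V) : set V :=
  smallest (@convex_set K V) A.

Definition circled (V : lmodType K) (A : set V) : set V :=
  [set w *: x | w in [set w : K | `|w| = 1] & x in A].

Definition L_projection (W : normedModType K) (P : {linear W -> W}) : Prop :=
  (forall w, P (P w) = P w) /\ (forall w, `|w| = `|P w| + `|w - P w|).

Definition L_summand (W : normedModType K) (A : set W) : Prop :=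
  exists2 P : {linear W -> W}, L_projection P & range P = A.

End normed_space.

Section dual_space.
Context {R : realType} {k : scalar_kind}.
Local Notation K := (scalar_field R k).
Variable V : normedModType K.

Definition dual_pred : {pred (V -> K^o)} :=
  [pred f | `[< linear f /\ continuous f >]].

Lemma dual_predP (f : V -> K^o) :
  reflect (linear f /\ continuous f) (f \in dual_pred).
Proof. exact: asboolP. Qed.

Lemma dual_submod_closed : submod_closed dual_pred.
Proof.
split.
  apply/dual_predP; split; first by move=> a u v /=; rewrite scaler0 addr0.
  exact: cst_continuous.
move=> a f g /dual_predP[fl fc] /dual_predP[gl gc].
apply/dual_predP; split.
  move=> b u v; rewrite !fctE fl gl.
  by rewrite !scalerDr !scalerA [b * a]mulrC addrACA.
by move=> x; apply: cvgD; [apply: cvgZr; exact: fc|exact: gc].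
Qed.

HB.instance Definition _ :=
  GRing.isSubmodClosed.Build K (V -> K^o) dual_pred dual_submod_closed.

Record dual := Dual { dual_fun :> V -> K^o; _ : dual_fun \in dual_pred }.

HB.instance Definition _ := [isSub for dual_fun].
HB.instance Definition _ := [Choice of dual by <:].
HB.instance Definition _ := [SubChoice_isSubLmodule of dual by <:].

Lemma dual_linear (f : dual) : linear f.
Proof. by have /dual_predP[] := valP f. Qed.

Lemma dual_continuous (f : dual) : continuous f.
Proof. by have /dual_predP[] := valP f. Qed.

HB.instance Definition _ (f : dual) :=
  GRing.isLinear.Build K V K^o *:%R (dual_fun f) (dual_linear f).

Implicit Types f g : dual.

Let values f : set R := [set re `|f x| | x in @unit_ball R k V].

(* A norm on a [normedModType K] takes its values in [K], so the supremum is
   computed in [R] and embedded back into [K]. *)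
Definition dual_norm f : K := of_real (sup (values f)).

Let has_sup_values f : has_sup (values f).
Proof.
split; first by exists (re `|f 0|), 0 => //; rewrite /unit_ball/= normr0.
have /linear_bounded_continuous/bounded_funP/(_ 1)[M fM] := @dual_continuous f.
exists (re M) => _ [x x1 <-]; apply: le_re => //; exact: fM.
Qed.

Let le_values f x : `|x| <= 1 -> re `|f x| <= sup (values f).
Proof. by move=> x1; apply: ub_le_sup; [case: (has_sup_values f)|exists x]. Qed.

Let sup_values_ge0 f : 0 <= sup (values f).
Proof.
apply: le_trans (le_values f (x := 0) _); last by rewrite normr0.
exact: re_ge0.
Qed.

Let sup_values_le f (r : R) :
  (forall x, `|x| <= 1 -> re `|f x| <= r) -> sup (values f) <= r.
Proof.
move=> fr; apply: ge_sup; first by case: (has_sup_values f).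
by move=> _ [x x1 <-]; exact: fr.
Qed.

Let dual_normD f g : dual_norm (f + g) <= dual_norm f + dual_norm g.
Proof.
rewrite /dual_norm -of_realD le_of_real; apply: sup_values_le => x x1.
rewrite (le_trans (le_re _ (ler_normD (f x) (g x))))// reD.
by rewrite lerD// le_values.
Qed.

Let dual_normZ_le (l : K) f : sup (values (l *: f)) <= re `|l| * sup (values f).
Proof.
apply: sup_values_le => x x1.
rewrite [X in re `|X|](_ : _ = l * f x)// normrM re_norm_mul.
by rewrite ler_wpM2l ?le_values// re_ge0.
Qed.

Let dual_normZ (l : K) f : dual_norm (l *: f) = `|l| * dual_norm f.
Proof.
rewrite /dual_norm -[in RHS](reK (normr_ge0 l)) -of_realM; congr of_real.
apply/eqP; rewrite eq_le dual_normZ_le/=.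
have [->|l0] := eqVneq l 0.
  by rewrite normr0 -(@of_real0 R k) of_realK mul0r.
rewrite -[f in X in X <= _](scalerK l0).
rewrite (le_trans (ler_wpM2l _ (dual_normZ_le l^-1 (l *: f))))//.
  exact: re_ge0.
rewrite mulrA -re_norm_mul -normrM divff// normr1.
suff -> : re (1 : K) = 1 by rewrite mul1r.
by case: (k).
Qed.

Let dual_norm0_eq0 f : dual_norm f = 0 -> f = 0.
Proof.
move=> f0; apply/val_inj/funext => x /=.
have s0 : sup (values f) = 0.
  by rewrite -[LHS](@of_realK R k) [of_real _]f0 -(@of_real0 R k) of_realK.
have ball0 y : `|y| <= 1 -> f y = 0.
  move=> /(le_values f); rewrite s0 => fy0; apply/eqP; rewrite -normr_le0.
  by rewrite -(reK (normr_ge0 (f y))) -(@of_real0 R k) le_of_real.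
have [->|x0] := eqVneq x 0; first by rewrite linear0.
have nx0 : `|x| != 0 by rewrite normr_eq0.
rewrite -[x](scalerKV nx0) linearZ/= ball0 ?scaler0//.
by rewrite normfZV.
Qed.

HB.instance Definition _ := @Lmodule_isNormed.Build K dual
  dual_norm dual_normD dual_normZ dual_norm0_eq0.

End dual_space.

Section subspace_space.
Context {R : realType} {k : scalar_kind}.
Local Notation K := (scalar_field R k).
Variables (V : normedModType K) (X : submodClosed V).

Record subspace_type := Subspace { subspace_val :> V; _ : subspace_val \in X }.

HB.instance Definition _ := [isSub for subspace_val].
HB.instance Definition _ := [Choice of subspace_type by <:].
HB.instance Definition _ := [SubChoice_isSubLmodule of subspace_type by <:].

Let subspace_norm (x : subspace_type) : K := `|val x|.

Let subspace_normD x y :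
  subspace_norm (x + y) <= subspace_norm x + subspace_norm y.
Proof. exact: ler_normD. Qed.

Let subspace_normZ (l : K) x : subspace_norm (l *: x) = `|l| * subspace_norm x.
Proof. exact: normrZ. Qed.

Let subspace_norm0_eq0 x : subspace_norm x = 0 -> x = 0.
Proof. by move=> /normr0_eq0 x0; apply: val_inj. Qed.

HB.instance Definition _ := @Lmodule_isNormed.Build K subspace_type
  subspace_norm subspace_normD subspace_normZ subspace_norm0_eq0.

End subspace_space.

Section lush_M_ideal.
Context {R : realType} {k : scalar_kind}.
Local Notation K := (scalar_field R k).

Definition slice (V : normedModType K) (f : dual V) (alpha : R) : set V :=
  [set x | unit_ball x /\ re (f x) > 1 - alpha].

Definition lush (V : normedModType K) : Prop :=
  forall (u v : V) (eps : R), unit_sphere u -> unit_sphere v -> 0 < eps ->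
  exists f : dual V, [/\ unit_sphere f, slice f eps u &
    (dist v (convex_hull (circled (slice f eps))) < eps%:E)%E].

Definition annihilator (Z : normedModType K) (X : submodClosed Z) :
  set (dual Z) := [set f | forall x, x \in X -> f x = 0].

Definition M_ideal (Z : normedModType K) (X : submodClosed Z) : Prop :=
  closed [set x | x \in X] /\ L_summand (annihilator X).

End lush_M_ideal.

(* Main.v *)
From HB Require Import structures.
Require Import Defs.
From mathcomp Require Import all_boot all_order all_algebra.
From mathcomp Require Import complex.
From mathcomp Require Import all_classical all_reals.
From mathcomp Require Import ereal topology normedtype convex.
From mathcomp Require Import ring lra.

Set Implicit Arguments.
Unset Strict Implicit.
Unset Printing Implicit Defensive.

Import Order.TTheory GRing.Theory Num.Theory.
Import numFieldNormedType.Exports.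

Local Open Scope classical_set_scope.
Local Open Scope ring_scope.

(** Lushness of [Z] produces a functional [z'] whose slice contains [u] and
    whose slice has a balanced convex hull coming close to [v]; the point is to
    move both facts down to [X].  Let [P] be the L-projection of the dual of
    [Z] onto the annihilator of [X].  The kernel of [P] is an isometric copy of
    the dual of [X] under restriction: a Hahn-Banach extension [h] of a
    functional on [X] may be replaced by [h - P h], which has the same
    restriction and no larger norm, and a functional in the kernel is
    determined by its restriction ([ker_extension], [ker_norm_le]).

    Since [u] lies in [X], the part [z' - P z'] is almost as large at [u] as
    [z'] has norm, so [P z'] is small by additivity of the norm.  Hence [z'] is
    nearly an element of the kernel, and its normalized restriction [f] to [X]
    defines a slice that contains [u].

    Suppose that [v] were at distance at least [eps] from the balanced convex
    hull of the slice of [f].  A functional [g] of norm at most 1 on [X]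
    separates them: on the slice, [g] stays below [s := g v - eps].  Then
    [g + eps^-1 f] is bounded by [s + eps^-1] on the whole unit ball of [X], on
    the slice because [g <= s] there and off the slice because [f] loses [eps].
    This is a statement about a norm, so the isometry carries it to [Z], where
    evaluating it at the points of the slice of [z'] bounds the extension of
    [g] by almost [s] there ([re_ker_slice_le]).  As [v] is nearly a convex
    combination of rotations of such points, [g v] is almost at most [s],
    which contradicts [g v = s + eps].

    Both uses of Hahn-Banach, extension and separation, are instances of the
    Mazur-Orlicz theorem: a sublinear functional dominates a real linear one
    subject to a convex cone of constraints [q y <= r] as soon as the
    constraints are pointwise compatible with it.  Scalars are treated
    uniformly through real parts, since a [K]-linear functional is determined
    by its real part and every real-linear functional is the real part of a
    [K]-linear one. *)

(** * Real parts of scalars *)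

Section scalars.
Context {R : realType} {k : scalar_kind}.
Local Notation K := (scalar_field R k).
Implicit Types (a b c : K) (x y : R).

Lemma of_real1 : of_real 1 = 1 :> K.
Proof. by case: k. Qed.

Lemma re1 : re (1 : K) = 1 :> R.
Proof. by rewrite -of_real1 of_realK. Qed.

Lemma re0 : re (0 : K) = 0 :> R.
Proof. by rewrite -(@of_real0 R k) of_realK. Qed.

Lemma of_realN x : of_real (- x) = - of_real x :> K.
Proof. by case: k => //=; rewrite rmorphN. Qed.

Lemma reN a : re (- a) = - re a.
Proof. by move: a; case: k => //= -[]. Qed.

Lemma re_of_realM x a : re (of_real x * a) = x * re a.
Proof. by move: a; case: k => //= -[p q] /=; rewrite mul0r subr0. Qed.

Lemma norm_of_real x : 0 <= x -> `|of_real x : K| = of_real x.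
Proof. by move=> x0; apply: ger0_norm; rewrite -(@of_real0 R k) le_of_real. Qed.

Lemma re_le_norm a : re a <= re `|a|.
Proof.
move: a; case: k => /= [a|a]; first exact: ler_norm.
by rewrite (le_trans (ler_norm _))// -lecR (le_trans (normc_ge_Re a)).
Qed.

Lemma phase a : exists2 w : K, `|w| = 1 & w * a = `|a|.
Proof.
have [->|a0] := eqVneq a 0; first by exists 1; rewrite ?normr1// mulr0 normr0.
have na0 : `|a| != 0 by rewrite normr_eq0.
by exists (`|a| / a); rewrite ?divfK// normrM normfV normr_id divff.
Qed.

(** The form [(a, b) |-> re (a * b)] is a perfect real pairing on the
    scalars.  Applied to [a |-> q (a *: x)], it recovers a [K]-linear functional
    from its real part [q] without a separate treatment of the complex case. *)
Lemma re_pairing_repr (phi : K -> R) :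
  (forall a b, phi (a + b) = phi a + phi b) ->
  (forall x a, phi (of_real x * a) = x * phi a) ->
  exists b, forall a, phi a = re (a * b).
Proof.
move: phi; case: k => /= phi phiD phiZ.
  by exists (phi 1) => a; rewrite -phiZ mulr1.
(* If phi = re (_ * b), then phi 1 = Re b and phi i = - Im b. *)
exists (Complex (phi 1) (- phi 'i%C)) => -[x y] /=.
rewrite mulrN opprK -!phiZ -phiD; congr phi.
by rewrite /=; apply/eqP; rewrite eq_complex /=; apply/andP; split; apply/eqP;
  ring.
Qed.

Lemma re_pairing_inj b c : (forall a, re (a * b) = re (a * c)) -> b = c.
Proof.
move=> bc; apply/eqP; rewrite -subr_eq0 -normr_eq0.
have [w _ wbc] := phase (b - c).
have : re `|b - c| = 0 by rewrite -wbc mulrBr reD reN bc subrr.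
by rewrite -[X in X == 0]reK// => ->; rewrite of_real0.
Qed.

End scalars.

(** * The Mazur-Orlicz theorem *)

Section mazur_orlicz.
Context {R : realType} {k : scalar_kind}.
Local Notation K := (scalar_field R k).
Variable V : lmodType K.
Implicit Types (p q : V -> R) (G : set (V * R)) (x y : V) (r t : R).

(** The inequality for all [t > 0] already gives positive homogeneity, by
    applying it to [t^-1] as well. *)
Definition sublinear p :=
  (forall x y, p (x + y) <= p x + p y) /\
  (forall t x, 0 < t -> p (of_real t *: x) <= t * p x).

(** A pair [(y, r)] of [G] stands for the constraint [q y <= r] on a linear
    functional [q]; linear consequences of constraints with positive
    coefficients are again constraints. *)
Definition cone G :=
  [/\ G (0, 0),
      forall y r y' r', G (y, r) -> G (y', r') -> G (y + y', r + r') &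
      forall t y r, 0 < t -> G (y, r) -> G (of_real t *: y, t * r)].

Lemma of_realKV t x : 0 < t -> of_real t^-1 *: (of_real t *: x) = x.
Proof. by move=> t0; rewrite scalerA -of_realM mulVf ?gt_eqF// of_real1
  scale1r. Qed.

Lemma sublinearZ p t x : sublinear p -> 0 < t -> p (of_real t *: x) = t * p x.
Proof.
move=> [_ pZ] t0; apply/eqP; rewrite eq_le pZ//=.
rewrite -ler_pdivlMl//; have := pZ t^-1 (of_real t *: x).
by rewrite of_realKV// invr_gt0; apply.
Qed.

Lemma sublinear0 p : sublinear p -> p 0 = 0.
Proof. by move=> /(sublinearZ 0 (t := 2)); rewrite scaler0 => /(_ ltac:(lra));
  lra. Qed.

Lemma sublinearN p x : sublinear p -> - p (- x) <= p x.
Proof. by move=> ps; have [pD _] := ps; have := pD x (- x);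
  rewrite subrr sublinear0//; lra. Qed.

(** This is the largest sublinear functional below [p] that satisfies the
    constraints of [G]. *)
Definition cone_inf p G x : R := inf [set p (x - yr.1) + yr.2 | yr in G].

Section cone_inf.
Variables (p : V -> R) (G : set (V * R)).
Hypotheses (ps : sublinear p) (Gc : cone G).
Hypothesis Gp : forall y r, G (y, r) -> 0 <= p (- y) + r.

Let cone_inf_lbound x : lbound [set p (x - yr.1) + yr.2 | yr in G] (- p (- x)).
Proof.
move=> _ [[y r] Gyr <-] /=; have [pD _] := ps.
have := pD (x - y) (- x); rewrite addrAC subrr sub0r.
by have := Gp Gyr; lra.
Qed.

Lemma cone_inf_le x y r : G (y, r) -> cone_inf p G x <= p (x - y) + r.
Proof. by move=> Gyr; apply: ge_inf; [exists (- p (- x));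
  exact: cone_inf_lbound|exists (y, r)]. Qed.

Lemma le_cone_inf x m : (forall y r, G (y, r) -> m <= p (x - y) + r) ->
  m <= cone_inf p G x.
Proof.
move=> H; apply: lb_le_inf; last by move=> _ [[y r] Gyr <-]; exact: H.
by case: Gc => G0 _ _; eexists; exists (0, 0).
Qed.

Lemma cone_inf_le_sublinear x : cone_inf p G x <= p x.
Proof.
case: Gc => G0 _ _.
by rewrite (le_trans (cone_inf_le x G0))// subr0 addr0.
Qed.

Lemma cone_inf_le_cone y r : G (y, r) -> cone_inf p G y <= r.
Proof.
by move=> /(cone_inf_le y); rewrite subrr (sublinear0 ps) add0r.
Qed.

Lemma cone_inf_sublinear : sublinear (cone_inf p G).
Proof.
have [pD pZ] := ps; have [_ GD GZ] := Gc.
split=> [x x'|t x t0].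
  rewrite -lerBlDl; apply: le_cone_inf => y' r' Gy'.
  rewrite lerBlDl -lerBlDr; apply: le_cone_inf => y r Gy.
  rewrite lerBlDr (le_trans (cone_inf_le _ (GD _ _ _ _ Gy Gy')))//.
  by have := pD (x - y) (x' - y'); rewrite addrACA opprD; lra.
rewrite -ler_pdivrMl//; apply: le_cone_inf => y r Gy.
rewrite ler_pdivrMl// (le_trans (cone_inf_le _ (GZ _ _ _ t0 Gy)))//.
by rewrite -scalerBr sublinearZ// mulrDr.
Qed.

End cone_inf.

(** Pointwise infima of chains of sublinear functionals below [p] are finite,
    because each of them is at least [x |-> - p (- x)], so Zorn's lemma
    applies. *)
Lemma minimal_sublinear p : sublinear p ->
  exists q, [/\ sublinear q, forall x, q x <= p x &
    forall q', sublinear q' -> (forall x, q' x <= q x) -> q' = q].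
Proof.
move=> ps.
pose T := {q : V -> R | sublinear q /\ forall x, q x <= p x}.
pose below (q q' : T) := `[< forall x, sval q' x <= sval q x >].
have [||||[q [qs qp]] qmin] := @Zorn T below.
- by move=> q; apply/asboolP.
- by move=> q1 q2 q3 /asboolP H1 /asboolP H2; apply/asboolP => x;
  apply: le_trans (H2 x) (H1 x).
- move=> [q1 H1] [q2 H2] /asboolP/= H12 /asboolP/= H21; apply: eq_exist.
  by apply/funext => x; apply/le_anti; rewrite H12 H21.
- move=> A Atot.
  have [[q0 Aq0]|A0] := pselect (A !=set0); last first.
    by exists (exist _ p (conj ps (fun=> lexx _))) => s As; case: A0; exists s.
  pose m x := inf [set sval q x | q in A].
  have mle (q : T) x : A q -> m x <= sval q x.
    move=> Aq; apply: ge_inf; last by exists q.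
    exists (- p (- x)) => _ [[q' [q's q'p]] Aq' <-] /=.
    by rewrite (le_trans _ (sublinearN x q's))// lerN2.
  have lem x r : (forall q : T, A q -> r <= sval q x) -> r <= m x.
    move=> H; apply: lb_le_inf; first by exists (sval q0 x), q0.
    by move=> _ [q Aq <-]; exact: H.
  suff mP : sublinear m /\ forall x, m x <= p x.
    by exists (exist _ m mP) => s As; apply/asboolP => x /=; exact: mle.
  split; last by move=> x; apply: le_trans (mle q0 x Aq0) _; case: (svalP q0).
  split=> [x y|t x t0].
    rewrite -lerBlDl; apply: (lem y) => q2 Aq2; rewrite lerBlDl -lerBlDr.
    apply: (lem x) => q1 Aq1; rewrite lerBlDr.
    have [/asboolP H|/asboolP H] := Atot _ _ Aq1 Aq2.
      apply: le_trans (mle q2 _ Aq2) _; have [[qD _] _] := svalP q2.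
      by apply: le_trans (qD _ _) _; rewrite lerD2r.
    apply: le_trans (mle q1 _ Aq1) _; have [[qD _] _] := svalP q1.
    by apply: le_trans (qD _ _) _; rewrite lerD2l.
  rewrite -ler_pdivrMl//; apply: lem => q Aq; rewrite ler_pdivrMl//.
  by apply: le_trans (mle q _ Aq) _; have [[_ qZ] _] := svalP q; exact: qZ.
exists q; split=> // q' q's q'q.
have q'p x : q' x <= p x by apply: le_trans (q'q x) (qp x).
have := qmin (exist _ q' (conj q's q'p)).
by move=> /(_ ltac:(by apply/asboolP)) /(congr1 sval).
Qed.

(** Adding the constraint [q (- a) <= - q a] to [q] gives a smaller sublinear
    functional; by minimality that is [q] itself, which thus satisfies it. *)
Lemma minimal_sublinear_odd q : sublinear q ->
  (forall q', sublinear q' -> (forall x, q' x <= q x) -> q' = q) ->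
  forall a, q (- a) = - q a.
Proof.
move=> qs qmin a.
pose G : set (V * R) := [set yr | exists2 t, 0 <= t & yr = (of_real t *: - a,
  - (t * q a))].
have Gc : cone G.
  split.
  - by exists 0; rewrite // of_real0 scale0r mul0r oppr0.
  - move=> _ _ _ _ [t t0 [-> ->]] [t' t'0 [-> ->]]; exists (t + t');
    first exact: addr_ge0.
    by rewrite of_realD scalerDl mulrDl opprD.
  - move=> t _ _ t0 [t' t'0 [-> ->]]; exists (t * t');
    first by rewrite mulr_ge0// ltW.
    by rewrite scalerA of_realM mulrN mulrA.
have Gq y r : G (y, r) -> 0 <= q (- y) + r.
  move=> [t]; rewrite le_eqVlt => /predU1P[<- [-> ->]|t0 [-> ->]].
    by rewrite of_real0 scale0r oppr0 sublinear0// mul0r subr0.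
  by rewrite scalerN opprK sublinearZ// subrr.
have qE := qmin _ (cone_inf_sublinear qs Gc Gq) (cone_inf_le_sublinear qs Gc
  Gq).
apply/le_anti/andP; split; last first.
  by have := sublinearN (- a) qs; rewrite opprK; lra.
rewrite -{1}qE; apply: cone_inf_le_cone => //.
by exists 1; rewrite // of_real1 scale1r mul1r.
Qed.

(** A minimal sublinear functional below [cone_inf p G] is odd, and an odd
    sublinear functional is linear. *)
Theorem mazur_orlicz p G : sublinear p -> cone G ->
    (forall y r, G (y, r) -> 0 <= p (- y) + r) ->
  exists q, [/\ forall x y, q (x + y) = q x + q y,
    forall t x, q (of_real t *: x) = t * q x,
    forall x, q x <= p x & forall y r, G (y, r) -> q y <= r].
Proof.
move=> ps Gc Gp.
have [q [qs qle qmin]] := minimal_sublinear (cone_inf_sublinear ps Gc Gp).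
have qN := minimal_sublinear_odd qs qmin.
have [qD _] := qs.
exists q; split.
- move=> x y; apply/le_anti; rewrite qD/=.
  by have := qD (- x) (- y); rewrite -opprD !qN; lra.
- move=> t x; have [t0|t0|->] := ltgtP t 0.
  + rewrite -[t]opprK of_realN scaleNr qN sublinearZ// ?mulNr// oppr_gt0//.
  + exact: sublinearZ.
  + by rewrite of_real0 scale0r mul0r sublinear0.
- by move=> x; apply: le_trans (qle x) (cone_inf_le_sublinear ps Gc Gp x).
- by move=> y r Gy; apply: le_trans (qle y) (cone_inf_le_cone ps Gp Gy).
Qed.

End mazur_orlicz.

(** * Real-valued norms and dual norms *)

Section norms.
Context {R : realType} {k : scalar_kind}.
Local Notation K := (scalar_field R k).

Lemma re_norm_ge0 (W : normedModType K) (x : W) : 0 <= re `|x|.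
Proof. exact: re_ge0. Qed.

Lemma le1_re (W : normedModType K) (x : W) : (`|x| <= 1) = (re `|x| <= 1).
Proof. by rewrite -[`|x|]reK// -of_real1 le_of_real of_realK. Qed.

Lemma re_normD (W : normedModType K) (x y : W) : re `|x + y| <= re `|x| + re
  `|y|.
Proof. by rewrite -reD le_re// ler_normD. Qed.

Lemma re_normZ (W : normedModType K) (a : K) (x : W) : re `|a *: x| = re `|a| *
  re `|x|.
Proof.
by rewrite normrZ -[in LHS](reK (normr_ge0 a)) -[in LHS](reK (normr_ge0 x))
  -of_realM of_realK.
Qed.

Lemma re_normZ_real (W : normedModType K) (t : R) (x : W) : 0 <= t ->
  re `|of_real t *: x| = t * re `|x|.
Proof. by move=> t0; rewrite re_normZ norm_of_real// of_realK. Qed.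

Lemma sublinear_norm (W : normedModType K) (M : R) : 0 <= M ->
  sublinear (fun x : W => M * re `|x|).
Proof.
move=> M0; split=> [x y|t x t0]; first by rewrite -mulrDr ler_wpM2l// re_normD.
by rewrite re_normZ_real ?(ltW t0)// mulrCA.
Qed.

End norms.

Section dual_norms.
Context {R : realType} {k : scalar_kind}.
Local Notation K := (scalar_field R k).
Variable V : normedModType K.
Implicit Types (f g : dual V) (x : V).

Lemma dual_normE f : `|f| = of_real (sup [set re `|f x| | x in @unit_ball R k
  V]) :> K.
Proof. by []. Qed.

(** It is enough to bound real parts: multiplying [x] by a suitable phase turns
    [re (f x)] into [`|f x|]. *)
Lemma re_dual_norm_le f M : (forall x,
  re `|x| <= 1 -> re (f x) <= M) -> re `|f| <= M.
Proof.
move=> fM; rewrite dual_normE of_realK; apply: ge_sup.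
  by exists (re `|f 0|), 0 => //; rewrite /unit_ball/= normr0.
move=> _ [x x1 <-]; have [w w1 wfx] := phase (f x : K).
rewrite -wfx -[w * _]/(w *: f x) -linearZ; apply: fM.
by rewrite re_normZ w1 re1 mul1r -le1_re.
Qed.

Lemma re_dual_bound f x : re (f x) <= re `|f| * re `|x|.
Proof.
have ball y : `|y| <= 1 -> re (f y) <= re `|f|.
  move=> y1; rewrite dual_normE of_realK (le_trans (re_le_norm _))//.
  apply: ub_le_sup; last by exists y.
  have /linear_bounded_continuous/bounded_funP/(_ 1)[M fM] := @dual_continuous
    _ _ _ f.
  by exists (re M) => _ [z z1 <-]; apply: le_re => //; exact: fM.
have [->|x0] := eqVneq x 0; first by rewrite linear0 re0 normr0 re0 mulr0.
have rx0 : 0 < re `|x|.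
  rewrite lt_def re_norm_ge0 andbT; apply: contra x0 => /eqP rx.
  by rewrite -normr_eq0 -[`|x|]reK// rx of_real0.
rewrite -ler_pdivrMr// mulrC -re_of_realM -[_ * _]/(of_real (re `|x|)^-1 *: f
  x) -linearZ.
by apply: ball; rewrite le1_re re_normZ_real ?invr_ge0 ?(ltW rx0)// mulVf//
  gt_eqF.
Qed.

Lemma dual_of_re (q : V -> R) (M : R) : 0 <= M ->
  (forall x y, q (x + y) = q x + q y) ->
  (forall t x, q (of_real t *: x) = t * q x) ->
  (forall x, q x <= M * re `|x|) ->
  exists f : dual V, forall x, re (f x) = q x.
Proof.
move=> M0 qD qZ qM.
have /choice[F qF] x : exists b : K, forall a : K, q (a *: x) = re (a * b).
  apply: re_pairing_repr => [a b|t a]; first by rewrite scalerDl qD.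
  by rewrite -scalerA qZ.
have Flin : linear (F : V -> K^o).
  move=> a x y; apply: re_pairing_inj => b.
  by rewrite -qF scalerDr scalerA qD !qF mulrDr reD -[a *: F x]/(a * F x) mulrA.
pose hF := GRing.isLinear.Build K V K^o *:%R F Flin.
pose Fl : {linear V -> K^o} := HB.pack (F : V -> K^o) hF.
have Fc : continuous Fl.
  apply/linear_bounded_continuous/bounded_funP => r;
    exists (of_real (M * re r)) => x xr.
  have [w w1 wFx] := phase (F x).
  rewrite -[`|_|]/(`|F x|) -wFx -[w * _]reK ?wFx// le_of_real -wFx -qF.
  rewrite (le_trans (qM _))// ler_wpM2l// re_normZ w1 re1 mul1r le_re//.
have Fd : (F : V -> K^o) \in @dual_pred R k V by apply/dual_predP; split;
  [exact: Flin|exact: Fc].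
by exists (Dual Fd) => x /=; rewrite -[x in RHS]scale1r qF mul1r.
Qed.

End dual_norms.
(** * Separation from a convex hull *)

Section separation.
Context {R : realType} {k : scalar_kind}.
Local Notation K := (scalar_field R k).
Variable V : normedModType K.
Implicit Types (C : set V) (v x y : V).

Lemma convex_hull_convex (A : set V) (t : R) x y : 0 <= t <= 1 ->
  convex_hull A x -> convex_hull A y ->
  convex_hull A (of_real t *: x + of_real (1 - t) *: y).
Proof.
move=> /andP[t0 t1] Ax Ay B [Bc AB].
have t0' : 0 <= of_real t :> K by rewrite -(@of_real0 R k) le_of_real.
have t1' : of_real t <= 1 :> K by rewrite -(@of_real1 R k) le_of_real.
have := Bc x y (Itv01 t0' t1');
  rewrite !inE => /(_ (Ax _ (conj Bc AB)) (Ay _ (conj Bc AB))).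
rewrite of_realD of_realN of_real1; exact.
Qed.

Lemma re_le_convex_hull (A : set V) (f : dual V) (M : R) :
  (forall x, A x -> re (f x) <= M) -> forall x,
    convex_hull A x -> re (f x) <= M.
Proof.
move=> AM x /(_ [set y | re (f y) <= M]); apply; split=> // y z l.
rewrite !inE /= => yM zM.
have l0 : 0 <= l%:num :> K by [].
have l1 : 0 <= 1 - l%:num :> K by rewrite subr_ge0.
rewrite -[conv l y z]/(l%:num *: y + (1 - l%:num) *: z).
have -> : re (f (l%:num *: y + (1 - l%:num) *: z)) =
    re (l%:num * (f y : K)) + re ((1 - l%:num) * (f z : K)).
  by rewrite linearD !linearZ reD.
rewrite -[X in re (X * _) + _](reK l0) -[X in _ + re (X * _)](reK l1).
rewrite [X in X + _]re_of_realM [X in _ + X]re_of_realM.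
by have := ler_wpM2l (re_ge0 l0) yM; have := ler_wpM2l (re_ge0 l1) zM;
  rewrite reD reN re1; lra.
Qed.

(** The constraints are [g (x - v) <= - eps] for [x] in the hull, together with
    their nonnegative multiples.  They form a cone because the hull is convex,
    and they are compatible with the norm because [`|v - x| >= eps]. *)
Lemma separate_convex_hull (A : set V) v (eps : R) : A !=set0 ->
  (forall x, convex_hull A x -> eps <= re `|v - x|) ->
  exists g : dual V, re `|g| <= 1 /\
    forall x, convex_hull A x -> re (g x) + eps <= re (g v).
Proof.
move=> [a Aa] Aeps.
have Ha : convex_hull A a by apply: sub_gen_smallest.
pose G : set (V * R) := [set yr | exists t, 0 <= t /\ exists2 x,
  convex_hull A x &
  yr = (of_real t *: (x - v), - (t * eps))].
have Gc : cone G.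
  split.
  - exists 0; split=> //; exists a => //.
    by rewrite of_real0 scale0r mul0r oppr0.
  - move=> _ _ _ _ [t [t0 [x Ax [-> ->]]]] [t' [t'0 [x' Ax' [-> ->]]]].
    (* t (x - v) + t' (x' - v) is t + t' times the difference of the weighted
       mean of x and x' and of v, unless both weights vanish. *)
    have [tt0|tt0] := eqVneq (t + t') 0.
      have [-> ->] : t = 0 /\ t' = 0 by split; lra.
      exists 0; split=> //; exists x => //.
      by rewrite of_real0 !scale0r mul0r oppr0 !addr0.
    exists (t + t'); split; first exact: addr_ge0.
    exists (of_real (t / (t + t')) *: x + of_real (1 - t / (t + t')) *: x').
      apply: convex_hull_convex => //; rewrite divr_ge0 ?addr_ge0//=.
      by rewrite ler_pdivrMr ?mul1r ?lerDl// lt_def tt0 addr_ge0.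
    congr pair; last by rewrite mulrDl opprD.
    rewrite [in RHS]scalerBr [in RHS]scalerDr !scalerA -!of_realM.
    rewrite mulrBr mulr1 mulrCA divff// mulr1 [t + t' - t]addrAC subrr add0r.
    by rewrite of_realD scalerDl !scalerBr opprD addrACA.
  - move=> t _ _ t0 [t' [t'0 [x Ax [-> ->]]]]; exists (t * t'); split.
      by rewrite mulr_ge0// ltW.
    by exists x => //; rewrite scalerA of_realM mulrN mulrA.
have [|q [qD qZ qle qG]] := mazur_orlicz (sublinear_norm V ler01) Gc.
  move=> _ _ [t [t0 [x Ax [-> ->]]]].
  rewrite -scalerN opprB re_normZ_real// mul1r -mulrBr mulr_ge0// subr_ge0.
  exact: Aeps.
have [g gq] := dual_of_re ler01 qD qZ qle.
exists g; split.
  by apply: re_dual_norm_le => x x1; rewrite gq (le_trans (qle x))// mul1r.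
move=> x Ax; have : re (g (x - v)) <= - eps.
  rewrite gq; apply: qG; exists 1; split=> //; exists x => //.
  by rewrite of_real1 scale1r mul1r.
by rewrite linearB reD reN; lra.
Qed.

End separation.

(** * The dual of an M-ideal *)

Section M_ideals.
Context {R : realType} {k : scalar_kind}.
Local Notation K := (scalar_field R k).
Variables (Z : normedModType K) (X : submodClosed Z).
Local Notation XT := (subspace_type X).

Lemma subspace_valD (x y : XT) : val (x + y) = val x + val y :> Z.
Proof. exact: raddfD. Qed.

Lemma subspace_valZ a (x : XT) : val (a *: x) = a *: val x :> Z.
Proof. exact: linearZ. Qed.

Lemma restriction (h : dual Z) :
  exists g : dual XT, forall x, g x = h (val x).
Proof.
have [||||g gh] := @dual_of_re R k XT (fun x => re (h (val x))) (re `|h|).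
- exact: re_norm_ge0.
- by move=> x y; rewrite subspace_valD linearD reD.
- by move=> t x; rewrite subspace_valZ linearZ; exact: re_of_realM.
- by move=> x; exact: re_dual_bound.
exists g => x; apply: re_pairing_inj => a.
rewrite -[a * g x]/(a *: g x) -[a * h _]/(a *: h (val x)).
by rewrite -linearZ gh subspace_valZ linearZ.
Qed.

(** The constraints [h x <= g x] for [x] in the subspace force equality, since
    they also hold at [- x]. *)
Lemma hahn_banach (g : dual XT) :
  exists2 h : dual Z, forall x, h (val x) = g x & re `|h| <= re `|g|.
Proof.
pose G : set (Z * R) := [set (val x, re (g x)) | x in [set: XT]].
have Gc : cone G.
  split.
  - by exists 0; rewrite // !linear0 re0.
  - move=> _ _ _ _ [x _ [<- <-]] [y _ [<- <-]]; exists (x + y) => //.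
    by rewrite subspace_valD linearD reD.
  - move=> t _ _ t0 [x _ [<- <-]]; exists (of_real t *: x) => //.
    by rewrite subspace_valZ linearZ; congr pair; exact: re_of_realM.
have [|q [qD qZ qle qG]] := mazur_orlicz (sublinear_norm Z (re_norm_ge0 g)) Gc.
  move=> _ _ [x _ [<- <-]].
  by have := re_dual_bound g (- x);
    rewrite linearN reN !normrN -[`|x|]/(`|val x|); lra.
have [h hq] := dual_of_re (re_norm_ge0 g) qD qZ qle.
exists h.
  have le x : re (h (val x)) <= re (g x) by rewrite hq; apply: qG; exists x.
  move=> x; apply: re_pairing_inj => a.
  rewrite -[a * g x]/(a *: g x) -[a * h _]/(a *: h (val x)).
  rewrite -!linearZ; apply/le_anti; rewrite le/=.
  by have := le (- (a *: x)); rewrite !linearN !reN lerN2.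
apply: re_dual_norm_le => x x1; rewrite hq (le_trans (qle x))//.
by rewrite -[leRHS]mulr1 ler_wpM2l// re_norm_ge0.
Qed.

Variable P : {linear dual Z -> dual Z}.
Hypotheses (PL : L_projection P) (PX : range P = annihilator X).

Lemma re_L_norm (w : dual Z) : re `|w| = re `|P w| + re `|w - P w|.
Proof. by case: PL => _ /(_ w) {1}->; rewrite reD. Qed.

Lemma L_projection_vanishes (w : dual Z) x : P w (val (x : XT)) = 0.
Proof.
have : annihilator X (P w) by rewrite -PX; exists w.
by apply; exact: valP.
Qed.

(** Subtracting [P h] from a norm-preserving extension [h] does not change it on
    [X], and does not increase the norm since [P] is an L-projection. *)
Lemma ker_extension (g : dual XT) :
  exists w : dual Z, [/\ P w = 0, forall x,
    w (val x) = g x & re `|w| <= re `|g|].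
Proof.
have [h hg hle] := hahn_banach g.
case: PL => PP _; exists (h - P h); split.
- by rewrite linearB PP subrr.
- by move=> x; rewrite -[LHS]/(h (val x) - P h (val x)) L_projection_vanishes
  subr0.
- by move: hle; rewrite (re_L_norm h); have := re_norm_ge0 (P h); lra.
Qed.

(** The extension of [g] given by [ker_extension] differs from [w] by an element
    that lies both in the kernel and in the range of [P], hence it is [w]. *)
Lemma ker_norm_le (w : dual Z) (g : dual XT) :
  P w = 0 -> (forall x, w (val x) = g x) -> re `|w| <= re `|g|.
Proof.
move=> Pw wg; have [w' [Pw' w'g w'le]] := ker_extension g.
suff -> : w = w' by [].
have : annihilator X (w - w').
  move=> x xX; rewrite -[LHS]/(w x - w' x).
  by rewrite -[x]/(val (Subspace xX)) wg w'g subrr.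
rewrite -PX => -[z _ zE]; case: PL => PP _.
have := PP z; rewrite zE linearB Pw Pw' subrr => /eqP; rewrite eq_sym subr_eq0.
by move/eqP.
Qed.

(** A bound on [g] over a slice of the ball of [X] becomes a bound for the norm
    of [g + eps^-1 *: f].  Norms are the same for functionals on [X] and for
    their extensions in the kernel of [P], so the bound passes to the points
    [z] of the ball of [Z] where [phi] is close to 1. *)
Lemma re_ker_slice_le (f g : dual XT) (phi w : dual Z) (eps s : R) (z : Z) :
  P phi = 0 -> (forall x, phi (val x) = f x) -> re `|f| <= 1 ->
  P w = 0 -> (forall x, w (val x) = g x) -> re `|g| <= 1 ->
  0 < eps -> 0 <= s ->
  (forall x, slice f eps x -> re (g x) <= s) ->
  re `|z| <= 1 -> re (w z) <= s + (1 - re (phi z)) / eps.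
Proof.
move=> Pphi phif f1 Pw wg g1 eps0 s0 gs z1.
pose t := eps^-1; have t0 : 0 < t by rewrite invr_gt0.
have gf : re `|g + of_real t *: f| <= s + t.
  apply: re_dual_norm_le => x x1.
  rewrite -[dual_fun _ x]/(g x + of_real t * f x) reD re_of_realM.
  have bnd (h : dual XT) : re `|h| <= 1 -> re (h x) <= 1.
    move=> h1; apply: le_trans (re_dual_bound h x) _.
    by rewrite mulr_ile1 ?re_norm_ge0.
  have fx := bnd f f1; have gx := bnd g g1.
  have [fs|fs] := ltP (1 - eps) (re (f x)).
    rewrite lerD//; first by apply: gs; split=> //; rewrite /unit_ball/= le1_re.
    by rewrite -[leRHS]mulr1 ler_wpM2l// ltW.
  have := ler_wpM2l (ltW t0) fs; rewrite mulrBr mulVf ?gt_eqF//; lra.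
have : re `|w + of_real t *: phi| <= s + t.
  apply: le_trans (ker_norm_le _ _) gf;
    first by rewrite linearD linearZ/= Pw Pphi scaler0 addr0.
  move=> x; rewrite -[LHS]/(w (val x) + of_real t * phi (val x)).
  by rewrite wg phif.
have := re_dual_bound (w + of_real t *: phi) z.
rewrite -[dual_fun _ z]/(w z + of_real t * phi z) reD re_of_realM.
have := ler_wpM2l (re_norm_ge0 (w + of_real t *: phi)) z1.
by rewrite -/t mulrBl mul1r [_ * t]mulrC; lra.
Qed.

End M_ideals.

(** * Lushness of M-ideals *)

Theorem theorem2 (R : realType) (k : scalar_kind)
    (Z : completeNormedModType (scalar_field R k)) (X : submodClosed Z)
    (Zlush : lush Z) (XM : M_ideal X) :
  lush (subspace_type X).
Proof.
case: XM => _ [P PL PX] u v eps u1 v1 eps0.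
(* d must satisfy d <= eps, so that the slice of f contains u, and
   2 d / eps + d < eps, for the final contradiction; e / 2 and e / 4 bound the
   two summands. *)
pose e := Num.min eps 1; pose d := e ^+ 2 / 4.
have e0 : 0 < e by rewrite lt_min eps0 ltr01.
have [e_eps e_1] : e <= eps /\ e <= 1 by split; rewrite ge_min lexx ?orbT.
have d0 : 0 < d by rewrite divr_gt0// exprn_gt0.
have d4 : d <= e / 4 by rewrite /d; nra.
have [z' [z'1 [_ z'u] z'v]] := Zlush (val u) (val v) d u1 v1 d0.
have rz' : re `|z'| = 1 by rewrite z'1 re1.
have re_unit (V : normedModType (scalar_field R k)) (x : V) : unit_sphere x ->
  re `|x| = 1.
  by move=> ->; exact: re1.
have [x' x'z'] := restriction X z'.
pose w0 := z' - P z'.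
have Pw0 : P w0 = 0 by rewrite linearB; case: PL => -> _; rewrite subrr.
have w0x' x : w0 (val x) = x' x.
  by rewrite -[LHS]/(z' (val x) - P z' (val x)) (L_projection_vanishes PX)
    subr0 x'z'.
pose n := re `|x'|.
have n1 : n <= 1.
  apply: re_dual_norm_le => x x1; rewrite x'z' (le_trans (re_dual_bound _ _))//.
  by rewrite rz' mul1r.
have nw0 : re `|w0| <= n by exact: (ker_norm_le PL PX).
have w0u : 1 - d < re `|w0|.
  have := re_dual_bound w0 (val u).
  rewrite (re_unit _ _ u1 : re `|val u| = 1) mulr1 w0x' x'z'.
  exact: lt_le_trans.
have n0 : 0 < n by lra.
have Pz' : re `|P z'| <= d by have := re_L_norm PL z'; rewrite rz' -/w0; lra.
pose f := of_real n^-1 *: x'; pose phi := of_real n^-1 *: w0.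
have f1 : `|f| = 1.
  rewrite -[`|f|]reK// re_normZ_real ?invr_ge0 ?(ltW n0)// mulVf ?gt_eqF//.
  exact: of_real1.
(* Passing from x' to f only increases the nonnegative values of interest, as
   n <= 1. *)
have fE x : re (f x) = n^-1 * re (x' x) by exact: re_of_realM.
have invn1 : 1 <= n^-1 by rewrite invf_ge1.
have fu : slice f eps u.
  split; first by rewrite /unit_ball/= le1_re (re_unit _ _ u1).
  have : 1 - d < re (x' u) by rewrite x'z'.
  by rewrite fE => ux'; nra.
exists f; split=> //; rewrite ltNge; apply/negP => far.
set A := circled _ in far.
have far_c c : convex_hull A c -> eps <= re `|v - c|.
  move=> Ac; rewrite -lee_fin; apply: le_trans far _.
  by apply: ereal_inf_lbound; exists c.
have Aw (w : scalar_field R k) x : `|w| = 1 -> slice f eps x -> A (w *: x).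
  by move=> w1 fx; exists w => //; exists x.
have [g [g1 gsep]] := separate_convex_hull (ex_intro _ _ (Aw 1 u (normr1 _)
  fu)) far_c.
pose s := re (g v) - eps.
have gA x : A x -> re (g x) <= s.
  by move=> Ax; have := gsep x (@sub_gen_smallest _ _ _ _ Ax); rewrite /s; lra.
(* The set A contains both u and - u. *)
have s0 : 0 <= s.
  have := gA _ (Aw 1 u (normr1 _) fu); have := gA _ (Aw (-1) u _ fu).
  rewrite normrN normr1 => /(_ erefl); rewrite scaleN1r scale1r linearN reN;
    lra.
have [w [Pw wg wle]] := ker_extension PL PX g.
have wz z : slice z' d z -> forall a,
  `|a| = 1 -> re (w (a *: z)) <= s + 2 * d / eps.
  move=> [z1 z'z] a a1; rewrite /unit_ball/= le1_re in z1.
  (* The functional is rotated instead of the point: the rotated point may leave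
     the slice of z', whereas rotating g preserves its bound on the balanced
     set A. *)
  have -> : re (w (a *: z)) = re ((a *: w) z) by rewrite linearZ.
  have phif x : phi (val x) = f x.
    by rewrite -[LHS]/(of_real n^-1 * w0 (val x)) w0x'.
  have Pphi : P phi = 0 by rewrite linearZ/= Pw0 scaler0.
  have := @re_ker_slice_le _ _ _ _ P PL PX f (a *: g) phi (a *: w) eps s z Pphi
    phif.
  rewrite f1 re1 re_normZ a1 re1 mul1r => /(_ (lexx _)).
  have -> : P (a *: w) = 0 by rewrite linearZ/= Pw scaler0.
  move=> /(_ erefl) H.
  apply: le_trans (H _ g1 eps0 s0 _ z1) _.
  - by move=> x; rewrite -[LHS]/(a * w (val x)) wg.
  - move=> x fx; rewrite -[dual_fun _ x]/(a *: g x) -linearZ; apply: gA.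
    exact: Aw.
  - rewrite lerD2l ler_wpM2r ?invr_ge0 ?(ltW eps0)//.
    have -> : re (phi z) = n^-1 * re (w0 z) by exact: re_of_realM.
    have : re (w0 z) = re (z' z) - re (P z' z) by rewrite -reN -reD.
    have := re_dual_bound (P z') z;
      have := ler_pM (re_norm_ge0 (P z')) (re_norm_ge0 z) Pz' z1.
    rewrite mulr1 => *; nra.
have [_ /= [c cA <-]] := ereal_inf_lt z'v; rewrite lte_fin => vc.
have wc : re (w c) <= s + 2 * d / eps.
  apply: re_le_convex_hull cA => _ [a a1 [z zs <-]]; exact: wz.
have wvc : re (w (val v)) = re (w (val v - c)) + re (w c).
  by rewrite linearB reD reN subrK.
have := re_dual_bound w (val v - c).
have : re `|w| * re `|val v - c| <= d.
  rewrite -[leRHS]mul1r ler_pM ?re_norm_ge0 ?(ltW vc)//.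
  exact: le_trans wle g1.
have deps : 2 * d / eps <= e / 2.
  rewrite ler_pdivrMr// /d; nra.
by move: wvc; rewrite wg /s in wc *; move: wc; rewrite /s; lra.
Qed.
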